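(* There exists a universal constant $C>0$ such that the following holds for all $\mu,\nu$ satisfying the standing assumptions and all $\varepsilon>0$. Assume that $\nabla\varphi$ is $L$-Lipschitz and that $\operatorname{spt}\mu$ is star-shaped. Then for any $(x,y)\in\operatorname{spt}\pi_\varepsilon$ we have $$\|y-\nabla\varphi(x)\|\le C(L+1)^{3/2}\max\left(\sqrt[4]{\delta\Big(\frac{\delta(\varepsilon)}{L+1}\Big)},\ \sqrt{\delta\Big(\frac{\delta(\varepsilon)}{L+1}\Big)}\right).$$
   Context: Work in $\mathbb R^d$, $d\in\mathbb N$, with Euclidean norm; $B(x,r)$ is the open ball. Standing assumptions: $\mu$ is a Borel probability measure on $\mathbb R^d$, absolutely continuous with respect to Lebesgue measure, $\operatorname{spt}\mu\subseteq B(0,1)$, and the interior of $\operatorname{spt}\mu$ is connected; $\nu$ is a Borel probability measure on $\mathbb R^d$ with $\operatorname{spt}\nu\subseteq B(0,1)$. $\varphi:\mathbb R^d\to\mathbb R$ is the Brenier potential, i.e. a convex function with $\nu=(\nabla\varphi)_\sharp\mu$; $\nabla\varphi$ is the Monge map for the quadratic cost. Put $c(x,y)=\tfrac12\|x-y\|^2$ and $\mathbb P=\mu\otimes\nu$ (so $\operatorname{spt}\mathbb P=\operatorname{spt}\mu\times\operatorname{spt}\nu$). A set $A$ is star-shaped if there is a point $x_0\in A$ such that $\{tx_0+(1-t)x:t\in[0,1]\}\subseteq A$ for every $x\in A$. $\varepsilon$-spread of $\mu$: $\delta(\varepsilon):=\inf\{r>0: r\cdot\rho(r)>\varepsilon\}$,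 where $\rho(r):=\inf_{x\in\operatorname{spt}\mu}\mu(B(x,r))$. Quadratically regularized optimal transport: for $\varepsilon>0$, $\pi_\varepsilon$ is the unique minimizer over couplings $\pi$ of $\mu$ and $\nu$ of $\int c\,d\pi+\frac{\varepsilon}{2}\|\frac{d\pi}{d\mathbb P}\|^2_{L^2(\mathbb P)}$. It has density $\frac{d\pi_\varepsilon}{d\mathbb P}(x,y)=\frac1\varepsilon[f_\varepsilon(x)+g_\varepsilon(y)-c(x,y)]_+$, where the optimal dual potentials $f_\varepsilon,g_\varepsilon:\mathbb R^d\to\mathbb R$ are continuous and determined, up to a constant shift $(f_\varepsilon+a,g_\varepsilon-a)$, by $$\int[f_\varepsilon(x)+g_\varepsilon(y)-c(x,y)]_+\,\mu(dx)=\varepsilon\ \ \forall y\in\mathbb R^d,\qquad \int[f_\varepsilon(x)+g_\varepsilon(y)-c(x,y)]_+\,\nu(dy)=\varepsilon\ \ \forall x\in\mathbb R^d.$$ The support of $\pi_\varepsilon$ is $\operatorname{spt}\pi_\varepsilon:=\overline{\{(x,y)\in\operatorname{spt}\mathbb P: f_\varepsilon(x)+g_\varepsilon(y)>c(x,y)\}}$. *)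

(* Defs.v *)
From HB Require Import structures.
From mathcomp Require Import all_boot all_order all_algebra.
From mathcomp Require Import all_classical all_reals all_analysis.

Set Implicit Arguments.
Unset Strict Implicit.
Unset Printing Implicit Defensive.

Import Order.TTheory GRing.Theory Num.Theory.
Import numFieldNormedType.Exports.

Local Open Scope classical_set_scope.
Local Open Scope ring_scope.

(* R^d is 'rV[R]_d, whose library topology is the usual one, here equipped with
   its Borel sigma-algebra. The library norm `|x| on 'rV[R]_d is the sup norm:
   the Euclidean norm is enorm below. *)
Section borel_rV.
Context (R : realType) (d : nat).
Let G : set_system 'rV[R]_d := @open 'rV[R]_d.

HB.instance Definition _ := @isMeasurable.Build (sigma_display G) 'rV[R]_d
  <<s G >> (@sigma_algebra0 _ setT G) (@sigma_algebraC _ G)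
  (@sigma_algebra_bigcup _ setT G).
End borel_rV.

Section euclidean.
Context (R : realType) (d : nat).
Implicit Types (x y : 'rV[R]_d) (A : set 'rV[R]_d).

Definition enorm x : R := Num.sqrt (\sum_(i < d) x ord0 i ^+ 2).

Definition eball x (r : R) : set 'rV[R]_d := [set y | enorm (y - x) < r].

Definition cost x y : R := 2^-1 * enorm (x - y) ^+ 2.

Definition star_shaped A := exists2 x0, A x0 &
  forall x, A x -> forall t : R, 0 <= t <= 1 -> A (t *: x0 + (1 - t) *: x).

(* Junk value at the points where phi is not differentiable. *)
Definition grad (phi : 'rV[R]_d -> R) x : 'rV[R]_d :=
  \row_(i < d) 'D_(delta_mx ord0 i) phi x.

(* The library's k.-lipschitz is relative to the sup norm. *)
Definition lipschitz_grad (L : R) (phi : 'rV[R]_d -> R) :=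
  (forall x, differentiable phi x) /\
  (forall x y, enorm (grad phi x - grad phi y) <= L * enorm (x - y)).

Definition box (a b : 'rV[R]_d) : set 'rV[R]_d :=
  [set x | forall i, a ord0 i <= x ord0 i <= b ord0 i].

(* Lebesgue outer measure on R^d for 0 < d; its restriction to the Borel sets
   is the d-dimensional Lebesgue measure. *)
Definition lebesgue_rV A : \bar R :=
  ereal_inf [set v | exists a b : nat -> 'rV[R]_d,
    [/\ forall k i, a k ord0 i <= b k ord0 i,
        A `<=` \bigcup_k box (a k) (b k) &
        v = (\sum_(k <oo) (\prod_(i < d) (b k ord0 i - a k ord0 i))%:E)%E]].

End euclidean.

Definition spt (R : realType) (T : topologicalType) (m : set T -> \bar R) :
    set T :=
  [set x | forall U : set T, open U -> U x -> (0 < m U)%E].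

Section quadratic_ot.
Context (R : realType) (d : nat).
Implicit Types (mu nu : probability 'rV[R]_d R) (eps : R).
Implicit Types (f g phi : 'rV[R]_d -> R).

(* The pushforward identity is between Borel measures, hence tested on
   measurable sets only. *)
Definition brenier_potential mu nu phi :=
  convex_function setT phi /\
  (forall A, measurable A -> nu A = pushforward mu (grad phi) A).

Definition standing_assumptions mu nu :=
  [/\ mu `<< @lebesgue_rV R d,
      spt mu `<=` eball 0 1,
      connected (interior (spt mu)) &
      spt nu `<=` eball 0 1].

Definition min_ball_mass mu (r : R) : \bar R :=
  ereal_inf [set mu (eball x r) | x in spt mu].

(* For eps > 0 the set is nonempty and bounded below by eps when the support of
   mu is bounded, so the real-valued inf is the genuine infimum. *)
Definition spread mu eps : R :=
  inf [set r : R | 0 < r /\ (eps%:E < r%:E * min_ball_mass mu r)%E].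

(* The optimal dual potentials f, g of quadratically regularized optimal
   transport, characterized by the first-order system; the optimal coupling has
   density (f x + g y - cost x y)_+ / eps with respect to mu \x nu. *)
Definition qot_potentials mu nu eps f g :=
  [/\ continuous f, continuous g,
      (forall y,
        \int[mu]_x (Num.max (f x + g y - cost x y) 0)%:E = eps%:E)%E &
      (forall x,
        \int[nu]_y (Num.max (f x + g y - cost x y) 0)%:E = eps%:E)%E].

(* The support of the optimal coupling with dual potentials f, g. *)
Definition spt_qot mu nu f g : set ('rV[R]_d * 'rV[R]_d) :=
  closure [set z | spt (mu \x nu)%E z /\ cost z.1 z.2 < f z.1 + g z.2].

End quadratic_ot.

(* Main.v *)
Require Import Defs.
From HB Require Import structures.
From mathcomp Require Import all_boot all_order all_algebra.
From mathcomp Require Import all_classical all_reals all_analysis.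
From mathcomp Require Import measurable_realfun ring lra.

(** Write T for the gradient of phi, F x = |x|^2/2 - f x and
    G y = |y|^2/2 - g y, so that f x + g y - cost x y is the excess
    <x, y> - F x - G y, and pull the second marginal back by T: both variables
    then range over the support S of mu, with excess h(x, z) at y = T z.

    Two bounds say that (F, G) almost solves the dual problem of unregularized
    transport. The potentials are 1-Lipschitz ([potential_lipschitz]), so a
    large excess at (x, z) persists on a ball around x; as the positive part of
    the excess integrates to eps, the excess is at most 4 spread(eps)
    ([excess_le]). Conversely the diagonal excess h(x, x) has nonnegative
    mean, because T is optimal and the positive part of h is, up to the factor
    eps, a density with both marginals mu ([diagonal_mass_le] is the
    quantitative form). Being Lipschitz, h(x, x) cannot be very negative
    anywhere on S without being so on a ball of substantial mass. This is where
    the iterated spread d2 = spread(spread(eps) / (L + 1)) appears: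
    h(x, x) >= - 8 (L + 1) d2 ([diagonal_ge]).

    Hence T x is an approximate subgradient of F at x, and an exact one of phi.
    Two convex functions with the same subgradients differ by a constant; here
    F - phi changes by at most O((L + 1) d2) + (L + 1) |x - y|^2 between two
    points of S ([potential_step]). Star-shapedness joins any two points of S
    by two segments in S; cutting them into about 1 / sqrt d2 pieces shows
    that F - phi oscillates by at most O((L + 1) max(sqrt d2, d2)) on S
    ([star_potential_le]).

    Finally, if h(x, z) > 0 then the tangent plane of phi at z almost touches
    phi at x, up to the same error, and for a convex function with Lipschitz
    gradient such a gap controls |T x - T z|^2 ([tangent_gap_ge]). Points y of
    the support of nu are limits of points T z, which gives the theorem, even
    with the factor L + 1 instead of its power 3/2. *)

Set Implicit Arguments.
Unset Strict Implicit.
Unset Printing Implicit Defensive.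

Import Order.TTheory GRing.Theory Num.Theory.
Import numFieldNormedType.Exports.

Local Open Scope classical_set_scope.
Local Open Scope ring_scope.

(** * Euclidean geometry of row vectors *)

Definition dot {R : realType} {d : nat} (x y : 'rV[R]_d) : R :=
  \sum_(i < d) x ord0 i * y ord0 i.

Section Euclidean.
Context {R : realType} {d : nat}.
Implicit Types x y z : 'rV[R]_d.

Lemma dotC x y : dot x y = dot y x.
Proof. by apply: eq_bigr => i _; rewrite mulrC. Qed.

Lemma dotDl x y z : dot (x + y) z = dot x z + dot y z.
Proof. by rewrite -big_split; apply: eq_bigr => i _; rewrite mxE mulrDl. Qed.

Lemma dotZl t x z : dot (t *: x) z = t * dot x z.
Proof. by rewrite mulr_sumr; apply: eq_bigr => i _; rewrite mxE mulrA. Qed.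

Lemma dotNl x z : dot (- x) z = - dot x z.
Proof. by rewrite -scaleN1r dotZl mulN1r. Qed.

Lemma dotBl x y z : dot (x - y) z = dot x z - dot y z.
Proof. by rewrite dotDl dotNl. Qed.

Lemma dotDr x y z : dot x (y + z) = dot x y + dot x z.
Proof. by rewrite !(dotC x) dotDl. Qed.

Lemma dotZr t x z : dot x (t *: z) = t * dot x z.
Proof. by rewrite !(dotC x) dotZl. Qed.

Lemma dotBr x y z : dot x (y - z) = dot x y - dot x z.
Proof. by rewrite !(dotC x) dotBl. Qed.

Lemma dotxx_ge0 x : 0 <= dot x x.
Proof. by apply: sumr_ge0 => i _; rewrite -expr2 sqr_ge0. Qed.

Lemma enormE x : enorm x = Num.sqrt (dot x x).
Proof. by congr Num.sqrt; apply: eq_bigr => i _; rewrite expr2. Qed.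

Lemma enorm_ge0 x : 0 <= enorm x.
Proof. exact: sqrtr_ge0. Qed.

Lemma enorm_sqr x : enorm x ^+ 2 = dot x x.
Proof. by rewrite enormE sqr_sqrtr // dotxx_ge0. Qed.

Lemma enormZ t x : enorm (t *: x) = `|t| * enorm x.
Proof.
by rewrite !enormE dotZl dotZr mulrA -expr2 sqrtrM ?sqr_ge0// sqrtr_sqr.
Qed.

Lemma enormN x : enorm (- x) = enorm x.
Proof. by rewrite -scaleN1r enormZ normrN1 mul1r. Qed.

Lemma enorm_distC x y : enorm (x - y) = enorm (y - x).
Proof. by rewrite -enormN opprB. Qed.

Lemma enorm0 : enorm (0 : 'rV[R]_d) = 0.
Proof. by rewrite -(scale0r 0) enormZ normr0 mul0r. Qed.

Lemma norm_coord_le_enorm x i : `|x ord0 i| <= enorm x.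
Proof.
rewrite -sqrtr_sqr; apply: ler_wsqrtr.
by rewrite (bigD1 i)//= lerDl sumr_ge0// => j _; rewrite sqr_ge0.
Qed.

Lemma norm_le_enorm x : `|x| <= enorm x.
Proof.
rewrite [leLHS]mx_normrE; apply: bigmax_le; first exact: enorm_ge0.
by move=> [i j] _ /=; rewrite (ord1 i) norm_coord_le_enorm.
Qed.

Lemma enorm_eq0 x : enorm x = 0 -> x = 0.
Proof.
by move=> x0; apply/eqP; rewrite -normr_le0 -x0 norm_le_enorm.
Qed.

(** Cauchy-Schwarz: expand the square norm of |y| x - |x| y. *)
Lemma dot_le x y : dot x y <= enorm x * enorm y.
Proof.
have [->|x0] := eqVneq x 0.
  by rewrite -(scale0r 0) dotZl mul0r mulr_ge0// enorm_ge0.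
have [->|y0] := eqVneq y 0.
  by rewrite -(scale0r 0) dotZr mul0r mulr_ge0// enorm_ge0.
have nx : 0 < enorm x.
  by rewrite lt_def enorm_ge0 andbT; apply: contraNN x0 => /eqP /enorm_eq0 ->.
have ny : 0 < enorm y.
  by rewrite lt_def enorm_ge0 andbT; apply: contraNN y0 => /eqP /enorm_eq0 ->.
have := dotxx_ge0 (enorm y *: x - enorm x *: y).
rewrite !(dotBl, dotBr, dotZl, dotZr) -!enorm_sqr (dotC y x).
move: (enorm x) (enorm y) (dot x y) nx ny => a b p a0 b0 h.
rewrite -subr_ge0 -(pmulr_rge0 _ (mulr_gt0 a0 b0)); lra.
Qed.

Lemma dot_le_unit x y : enorm y < 1 -> dot x y <= enorm x.
Proof.
move=> y1; apply: (le_trans (dot_le x y)).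
by rewrite ler_piMr ?enorm_ge0// ltW.
Qed.

Lemma dot_ge_unit x y : enorm y < 1 -> - enorm x <= dot x y.
Proof. by move=> y1; rewrite lerNl -dotNl -(enormN x) dot_le_unit. Qed.

(** By the parallelogram identity. *)
Lemma enorm_sub_unit x y : enorm x < 1 -> enorm y < 1 -> enorm (x - y) < 2.
Proof.
move=> x1 y1.
rewrite -(ltr_pXn2r (n := 2))// ?nnegrE ?enorm_ge0//.
have : dot (x - y) (x - y) + dot (x + y) (x + y) = 2 * (dot x x + dot y y).
  by rewrite !(dotBl, dotBr, dotDl, dotDr) (dotC y x); ring.
have := dotxx_ge0 (x + y); rewrite -!enorm_sqr.
have := enorm_ge0 x; have := enorm_ge0 y.
by move: (enorm (x + y)) (enorm (x - y)) (enorm x) (enorm y) x1 y1 => p q r s; nra.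
Qed.

Lemma costE x y :
  cost x y = 2^-1 * dot x x + 2^-1 * dot y y - dot x y.
Proof.
rewrite /cost enorm_sqr !(dotBl, dotBr) (dotC y x); lra.
Qed.

Lemma dot_continuous (f g : 'rV[R]_d -> 'rV[R]_d) :
  continuous f -> continuous g -> continuous (fun x => dot (f x) (g x)).
Proof.
have coord (h : 'rV[R]_d -> 'rV[R]_d) (i : 'I_d) :
    continuous h -> continuous (fun x => h x ord0 i).
  move=> ch x; apply: (@continuous_comp _ _ _ h (fun v : 'rV[R]_d => v ord0 i)).
    exact: ch.
  exact: coord_continuous.
move=> cf cg; apply: continuous_big => [|i _ x]; first exact: add_continuous.
exact: (cvgM (coord f i cf x) (coord g i cg x)).
Qed.

Lemma enorm_continuous : continuous (@enorm R d).
Proof.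
rewrite (_ : @enorm R d = Num.sqrt \o (fun x => dot x x)); last first.
  by apply/funext => x; rewrite enormE.
move=> x; apply: continuous_comp; last exact: sqrt_continuous.
by apply: dot_continuous => y; exact: cvg_id.
Qed.

Lemma enorm_sub_continuous x : continuous (fun y => enorm (y - x)).
Proof.
move=> y; apply: (@continuous_comp _ _ _ (fun y => y - x) (@enorm R d)).
  exact: (cvgB (@cvg_id _ (nbhs y)) (cvg_cst x)).
exact: enorm_continuous.
Qed.

Lemma open_eball x r : open (eball x r).
Proof.
rewrite (_ : eball x r = (fun y => enorm (y - x)) @^-1` [set s | s < r])//.
by apply: open_comp; [move=> y _; exact: enorm_sub_continuous|exact: open_lt].
Qed.

Lemma lipschitz_continuous (T : 'rV[R]_d -> 'rV[R]_d) (L : R) :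
  (forall x y, enorm (T x - T y) <= L * enorm (x - y)) -> continuous T.
Proof.
move=> TL x; apply/(@cvgrPdist_lt _ _ _ (nbhs x)) => e e0.
have cL : continuous (fun y : 'rV[R]_d => L * enorm (y - x)).
  by move=> y; exact: (cvgM (cvg_cst L) (@enorm_sub_continuous x y)).
have near_x : nbhs x [set y | L * enorm (y - x) < e].
  by apply: (cL x [set s | s < e]); rewrite subrr enorm0 mulr0; exact: lt_nbhsl.
apply: (@filterS _ (nbhs x) _ _ _ _ near_x) => y /=; rewrite enorm_distC.
by apply/le_lt_trans/(le_trans (norm_le_enorm _)).
Qed.

End Euclidean.

(** * Convex functions with Lipschitz gradient *)

Section ConvexGradient.
Context {R : realType} {d : nat}.
Implicit Types (phi : 'rV[R]_d -> R) (x y v : 'rV[R]_d).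

Lemma derive_grad phi x v :
  differentiable phi x -> 'D_v phi x = dot v (grad phi x).
Proof.
move=> dx; rewrite deriveE// [in LHS](row_sum_delta v) linear_sum/=.
apply: eq_bigr => i _; rewrite linearZ/= /grad mxE deriveE//.
Qed.

(** A convex function lies above its tangent planes: along the segment from x
    to y the difference quotients are at most phi y - phi x. *)
Lemma tangent_le phi x y : convex_function setT phi -> differentiable phi x ->
  phi x + dot (y - x) (grad phi x) <= phi y.
Proof.
move=> cphi dx; rewrite addrC -lerBrDr -derive_grad//.
have dq := cvg_dnbhs_at_right (diff_derivable (v := y - x) dx).
apply: (cvgr_to_le dq); near=> t.
have t0 : 0 < t by [].
have t1 : t < 1 by near: t; exact: nbhs_right_lt.
have := cphi (Itv01 (ltW t0) (ltW t1)) y x (in_setT _) (in_setT _).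
rewrite convRE /conv /= => phit.
have -> : t *: (y - x) + x = t *: y + (1 - t) *: x.
  by rewrite scalerBr scalerBl scale1r addrAC addrA.
rewrite [leLHS]mulrC ler_pdivrMr// lerBlDr (le_trans phit)// /unstable.onem; lra.
Unshelve. all: by end_near. Qed.

Section SmoothConvex.
Variables (phi : 'rV[R]_d -> R) (T : 'rV[R]_d -> 'rV[R]_d) (L : R).
Hypothesis tangent : forall x y, phi x + dot (y - x) (T x) <= phi y.
Hypothesis lipT : forall x y, enorm (T x - T y) <= L * enorm (x - y).

(** The tangent inequality at y, instead of integration of the gradient along
    the segment, costs a factor 2. *)
Lemma smooth_le x y : phi y <= phi x + dot (y - x) (T x) + L * enorm (y - x) ^+ 2.
Proof.
have := tangent y x; rewrite -opprB dotNl => tyx.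
have xy := dot_le (y - x) (T y - T x).
have := ler_wpM2l (enorm_ge0 (y - x)) (lipT y x).
by move: xy; rewrite dotBr; lra.
Qed.

(** Compare the tangent plane at z with the parabola at x, at the minimizer of
    their difference. *)
Lemma tangent_gap_ge x z : 0 < L ->
  enorm (T x - T z) ^+ 2 <= 4 * L * (phi x - phi z - dot (x - z) (T z)).
Proof.
move=> L0; set v := T x - T z.
have h1 := tangent z (x - (2 * L)^-1 *: v).
have h2 := smooth_le x (x - (2 * L)^-1 *: v).
have wx : x - (2 * L)^-1 *: v - x = - ((2 * L)^-1 *: v).
  by rewrite addrAC subrr add0r.
rewrite wx enormN enormZ exprMn real_normK ?num_real// enorm_sqr in h2.
rewrite addrAC (dotDl (x - z)) in h1; move: h1 h2.
rewrite enorm_sqr !dotNl !dotZl.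
have -> : dot v v = dot v (T x) - dot v (T z) by rewrite -dotBr.
move=> h1 h2; have := le_trans h1 h2.
move: (dot v (T x)) (dot v (T z)) (phi x) (phi z) (dot (x - z) _) => a b p q e h.
have L0' : L != 0 by rewrite gt_eqF.
rewrite -subr_ge0 in h; have := mulr_ge0 (ltW L0) h.
rewrite [X in 0 <= X -> _](_ : _ = L * (p - q - e) - (a - b) / 4).
  by move=> ?; lra.
by field.
Qed.

End SmoothConvex.
End ConvexGradient.

(** * Borel measures and their supports *)

Section BorelSupport.
Context {R : realType} {d : nat}.
Implicit Types (mu : probability 'rV[R]_d R) (A : set 'rV[R]_d).

Lemma open_measurable_rV A : open A -> measurable A.
Proof. by move=> oA; apply: sub_gen_smallest. Qed.

Lemma closed_measurable_rV A : closed A -> measurable A.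
Proof.
move=> cA; rewrite -(setCK A); apply: measurableC; apply: open_measurable_rV.
exact: closed_openC.
Qed.

Lemma continuous_measurable_rV (f : 'rV[R]_d -> R) :
  continuous f -> measurable_fun setT f.
Proof.
move=> /continuousP cf; apply: (measurability _ (RGenOpens.measurableE R)).
move=> _ [_ [a [b ->] <-]]; rewrite setTI; apply: open_measurable_rV.
exact/cf/interval_open.
Qed.

Lemma continuous_measurable_rV_rV (f : 'rV[R]_d -> 'rV[R]_d) :
  continuous f -> measurable_fun setT f.
Proof.
move=> /continuousP cf; apply: (measurability (@open 'rV[R]_d)) => //.
by move=> _ [A oA <-]; rewrite setTI; apply: open_measurable_rV; exact: cf.
Qed.

Lemma closed_spt mu : closed (spt mu).
Proof.
move=> x clx U oU Ux; have [y [sy Uy]] := clx U (open_nbhs_nbhs (conj oU Ux)).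
exact: sy.
Qed.

Lemma measurable_spt mu : measurable (spt mu).
Proof. by apply: closed_measurable_rV; exact: closed_spt. Qed.

(** A compact set that misses the support is covered by finitely many null open
    sets, and the complement of the support, being open, is a countable union
    of compact sets. *)
Lemma spt_null mu : mu (~` spt mu) = 0.
Proof.
pose K (n : nat) := [set x : 'rV[R]_d | `|x| <= n%:R /\
  forall y, spt mu y -> n.+1%:R^-1 <= `|x - y|].
have cK n : closed (K n).
  have -> : K n = (fun x => `|x|) @^-1` [set s | s <= n%:R] `&`
      \bigcap_(y in spt mu) (fun x => `|x - y|) @^-1` [set s | n.+1%:R^-1 <= s].
    by [].
  apply: closedI; first by apply: preimage_closed; [move=> *; exact: norm_continuous|exact: closed_le].
  apply: closed_bigI => y _; apply: preimage_closed; last exact: closed_ge.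
  by move=> x _; exact: (cvg_norm (cvgB (@cvg_id _ (nbhs x)) (cvg_cst y))).
have Knull n : mu.-negligible (K n).
  have : compact (K n).
    apply: bounded_closed_compact (cK n); exists n%:R; split => // M nM x [xn _].
    exact: le_trans xn (ltW nM).
  rewrite compact_cover => /(_ _ [set U | open U /\ mu U = 0] id) [].
  - by move=> U [].
  - move=> x [_ xK].
    have /existsNP[U /not_implyP[oU /not_implyP[Ux U0]]] : ~ spt mu x.
      move=> /xK; rewrite subrr normr0; apply/negP.
      by rewrite -ltNge invr_gt0 ltr0n.
    exists U => //; split=> //; apply/eqP; rewrite -measure_le0 leNgt; exact/negP.
  move=> D sD /negligibleS; apply; rewrite /cover bigcup_fset big_seq.
  apply: big_ind; [exact: negligible_set0|exact: negligibleU|].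
  move=> U /sD; rewrite inE => -[oU U0]; apply/negligibleP => //.
  exact: open_measurable_rV.
apply/negligibleP; first by apply: measurableC; exact: measurable_spt.
apply: negligibleS (negligible_bigcup Knull) => x sx.
have oC : open (~` spt mu) by apply: closed_openC; exact: closed_spt.
have /nbhs_normP[e e0 xe] : nbhs x (~` spt mu) by exact: open_nbhs_nbhs.
near \oo => n; exists n => //; split.
  by near: n; exact: nbhs_infty_ger.
move=> y sy; rewrite leNgt; apply/negP => xy; apply: (xe y) => //=.
by apply: (lt_trans xy); near: n; exact: near_infty_natSinv_lt (PosNum e0).
Unshelve. all: by end_near. Qed.

End BorelSupport.
Section IntegralSupport.
Context {R : realType} {d : nat}.
Variable mu : probability 'rV[R]_d R.
Hypothesis spt_unit : spt mu `<=` eball 0 1.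

Lemma spt_enorm_lt1 x : spt mu x -> enorm x < 1.
Proof. by move=> /spt_unit; rewrite /eball/= subr0. Qed.

Lemma compact_spt : compact (spt mu).
Proof.
apply: bounded_closed_compact (@closed_spt _ _ mu); exists 1; split => // M M1 x sx.
apply: le_trans (norm_le_enorm x) _; apply: ltW.
exact: lt_trans (spt_enorm_lt1 sx) M1.
Qed.

Lemma bounded_on_spt (f : 'rV[R]_d -> R) : continuous f ->
  exists2 M : R, 0 < M & forall x, spt mu x -> `|f x| <= M.
Proof.
move=> cf; have : compact (f @` spt mu).
  apply: continuous_compact compact_spt.
  exact: continuous_subspaceT.
move=> /compact_bounded[M [_ fM]]; exists (`|M| + 1); first by rewrite ltr_wpDl.
by move=> x sx; apply: fM; [rewrite (le_lt_trans (ler_norm M))// ltrDl|exists x].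
Qed.

End IntegralSupport.

(** * Regularity of the dual potentials *)

Section PotentialLipschitz.
Context {R : realType} {d : nat}.
Variable mu : probability 'rV[R]_d R.

Lemma le_integral_spt (u v : 'rV[R]_d -> \bar R) :
  measurable_fun setT u -> measurable_fun setT v ->
  (forall x, 0 <= u x)%E -> (forall x, 0 <= v x)%E ->
  (forall x, spt mu x -> u x <= v x)%E ->
  (\int[mu]_x u x <= \int[mu]_x v x)%E.
Proof.
move=> mu_ mv u0 v0 uv; apply: ae_ge0_le_integral => //.
exists (~` spt mu); split; [|exact: spt_null|].
  by apply: measurableC; exact: measurable_spt.
by move=> x /= nuv sx; apply: nuv => _; exact: uv.
Qed.

Lemma integral_prob_cst (c : R) : (\int[mu]_x c%:E = c%:E)%E.
Proof.
rewrite integral_cst// [X in (_ * X)%E](_ : _ = 1%E) ?mule1//.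
exact: probability_setT.
Qed.

(** If psi y exceeded psi y' + |y - y'| by s > 0, then the integrand at y would
    be at most that at y' lowered by s and truncated at 0. As the latter is
    bounded by some M, this loses at least the fraction s / M of the mass,
    whereas both integrals equal eps. *)
Lemma potential_lipschitz (k psi : 'rV[R]_d -> R) (eps : R) :
  spt mu `<=` eball 0 1 -> continuous k -> 0 < eps ->
  (forall y, \int[mu]_x (Num.max (dot x y - k x - psi y) 0)%:E = eps%:E)%E ->
  forall y y', psi y - psi y' <= enorm (y - y').
Proof.
move=> mu1 ck eps0 int_eps y y'; rewrite leNgt; apply/negP => gap.
have [s sE] : exists s : R, s = psi y - psi y' - enorm (y - y') by eexists.
have s0 : 0 < s by rewrite sE subr_gt0.
pose w z x := dot x z - k x - psi z.
have cw z : continuous (w z).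
  have cdot : continuous (fun x => dot x z).
    by apply: dot_continuous; [move=> x; exact: cvg_id|exact: cst_continuous].
  by move=> x; exact: (cvgB (cvgB (cdot x) (ck x)) (cvg_cst (psi z))).
have mw z : measurable_fun setT (fun x => Num.max (w z x) 0).
  apply: measurable_maxr; last exact: measurable_cst.
  exact: continuous_measurable_rV.
have [M M0 wM] := bounded_on_spt mu1 (cw y').
have q0 : 0 <= 1 - s / (M + s).
  by rewrite subr_ge0 ler_pdivrMr ?addr_gt0// mul1r lerDr ltW.
have : (\int[mu]_x (Num.max (w y x) 0)%:E <=
        \int[mu]_x ((1 - s / (M + s)) * Num.max (w y' x) 0)%:E)%E.
  apply: le_integral_spt => [||x|x|x sx]; rewrite ?lee_fin.
  - exact/measurable_EFinP.
  - apply/measurable_EFinP; apply: measurable_funM => //; exact: measurable_cst.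
  - by rewrite le_max lexx orbT.
  - by rewrite mulr_ge0// le_max lexx orbT.
  have wle : w y x <= w y' x - s.
    have := dot_le_unit (y - y') (spt_enorm_lt1 mu1 sx).
    by rewrite dotC dotBr /w sE; lra.
  have wx := le_trans (ler_norm _) (wM _ sx).
  rewrite ge_max; apply/andP; split; last first.
    by rewrite mulr_ge0// le_max lexx orbT.
  have [ws|sw] := leP (w y' x) s.
    by apply: (@le_trans _ _ 0); [lra|rewrite mulr_ge0// le_max lexx orbT].
  rewrite max_l; last by lra.
  apply: (le_trans wle).
  rewrite mulrBl mul1r lerD2l lerN2 mulrAC ler_pdivrMr ?addr_gt0//.
  by rewrite ler_pM2l//; lra.
under [X in (_ <= X)%E]eq_integral do rewrite EFinM.
rewrite ge0_integralZl//; first last.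
- by move=> x _; rewrite lee_fin le_max lexx orbT.
- exact/measurable_EFinP.
rewrite !int_eps -EFinM lee_fin mulrBl mul1r; apply/negP.
by rewrite -ltNge gtrBl mulr_gt0// divr_gt0// addr_gt0.
Qed.

End PotentialLipschitz.

(** * The spread of a measure *)

Section Spread.
Context {R : realType} {d : nat}.
Variable mu : probability 'rV[R]_d R.
Hypothesis spt_unit : spt mu `<=` eball 0 1.

Lemma measurable_eball (x : 'rV[R]_d) r : measurable (eball x r).
Proof. by apply: open_measurable_rV; exact: open_eball. Qed.

Lemma spread_set_nonempty eps : 
  [set r : R | 0 < r /\ (eps%:E < r%:E * min_ball_mass mu r)%E] !=set0.
Proof.
(* The support has diameter less than 2, so balls of radius at least 2 have
   full mass. *)
have r2 : 2 <= `|eps| + 2 by rewrite lerDr.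
have r0 : 0 < `|eps| + 2 by rewrite (lt_le_trans _ r2).
exists (`|eps| + 2); split => //=.
have : (1 <= min_ball_mass mu (`|eps| + 2))%E.
  apply: le_ereal_inf_tmp => _ [x sx <-].
  have <- : mu (spt mu) = 1%E.
    rewrite -(setCK (spt mu)) probability_setC ?spt_null ?sube0//.
    by apply: measurableC; exact: measurable_spt.
  apply: le_measure; rewrite ?inE; [exact: measurable_spt|exact: measurable_eball|].
  move=> y sy; apply: lt_le_trans r2.
  by apply: enorm_sub_unit; exact: (spt_enorm_lt1 spt_unit).
move=> mass1; apply: (@lt_le_trans _ _ ((`|eps| + 2)%:E * 1)%E).
  by rewrite mule1 lte_fin ltr_pwDr// ler_norm.
by rewrite lee_pmul2l.
Qed.

(** The function r |-> r * mu (B(x, r)) is nondecreasing and dominates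
    r * rho(r). *)
Lemma le_spread x r eps : spt mu x -> 
  (r%:E * mu (eball x r) <= eps%:E)%E -> r <= spread mu eps.
Proof.
move=> sx rx; apply: lb_le_inf; first exact: spread_set_nonempty.
move=> t [t0 et]; rewrite leNgt; apply/negP => tr.
move: et; apply/negP; rewrite -leNgt; apply: le_trans rx.
have r0 : 0 < r by exact: lt_trans tr.
apply: (@le_trans _ _ (t%:E * mu (eball x t))%E).
  by rewrite lee_pmul2l// ereal_inf_lbound//; exists x.
apply: lee_pmul => //; [by rewrite lee_fin ltW..|].
apply: le_measure; rewrite ?inE; [exact: measurable_eball..|].
by move=> y /= yt; exact: lt_trans yt tr.
Qed.

(** Balls have mass at most 1. *)
Lemma spread_ge x eps : spt mu x -> 0 < eps -> eps <= spread mu eps.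
Proof.
move=> sx eps0; apply: (le_spread sx).
rewrite -[leRHS]mule1 lee_pmul2l//; apply: probability_le1.
exact: measurable_eball.
Qed.

End Spread.

(** * Mean excess on the graph of the transport map *)

Section DiagonalMass.
Context {R : realType} {d : nat}.
Variables (mu : probability 'rV[R]_d R) (T : 'rV[R]_d -> 'rV[R]_d).
Variables (phi F G : 'rV[R]_d -> R) (eps : R).
Hypothesis spt_unit : spt mu `<=` eball 0 1.
Hypothesis tangent : forall x y, phi x + dot (y - x) (T x) <= phi y.
Hypotheses (T_cont : continuous T) (phi_cont : continuous phi).
Hypotheses (F_cont : continuous F) (G_cont : continuous G).
Hypothesis eps0 : 0 < eps.

Let h x z := dot x (T z) - F x - G z.

Hypothesis int_fst :
  forall z, (\int[mu]_x (Num.max (h x z) 0)%:E = eps%:E)%E.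
Hypothesis int_snd :
  forall x, (\int[mu]_z (Num.max (h x z) 0)%:E = eps%:E)%E.

Let measurable_excess : measurable_fun setT
  (fun p : 'rV[R]_d * 'rV[R]_d => Num.max (h p.1 p.2) 0).
Proof.
apply: measurable_maxr; last exact: measurable_cst.
apply: measurable_funB; last first.
  apply: (measurableT_comp (f := G) (g := snd)); last exact: measurable_snd.
  exact: continuous_measurable_rV.
apply: measurable_funB; last first.
  apply: (measurableT_comp (f := F) (g := fst)); last exact: measurable_fst.
  exact: continuous_measurable_rV.
apply: measurable_sum => i; apply: measurable_funM.
  apply: (measurableT_comp (f := fun x : 'rV[R]_d => x ord0 i) (g := fst)).
    by apply: continuous_measurable_rV => x; exact: coord_continuous.
  exact: measurable_fst.
apply: (measurableT_comp (f := fun z => T z ord0 i) (g := snd)).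
  apply: continuous_measurable_rV => x.
  apply: (@continuous_comp _ _ _ T (fun v : 'rV[R]_d => v ord0 i)).
    exact: T_cont.
  exact: coord_continuous.
exact: measurable_snd.
Qed.

Let cmax (f : 'rV[R]_d -> R) (a : R) : continuous f ->
  measurable_fun setT (fun x => Num.max (f x + a) 0).
Proof.
move=> cf; apply: measurable_maxr; last exact: measurable_cst.
apply: measurable_funD; last exact: measurable_cst.
exact: continuous_measurable_rV.
Qed.

(** Multiplying h(x, z) <= h(z, z) + b x - b z, where b = phi - F, by the
    nonnegative kernel k = max(h, 0) and integrating in both variables, the
    b terms cancel because both marginals of k are eps mu. So h(z, z) has
    nonnegative mean, and the conclusion is a Markov inequality. *)
Lemma diagonal_mass_le (eta t : R) (E : set 'rV[R]_d) :
  0 <= eta -> 0 <= t -> measurable E ->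
  (forall x, spt mu x -> h x x <= eta) ->
  (forall x, spt mu x -> E x -> h x x <= - t) ->
  ((eta + t)%:E * mu E <= eta%:E)%E.
Proof.
move=> eta0 t0 mE h_eta h_t.
have c_diag : continuous (fun x => h x x).
  have cdot : continuous (fun x => dot x (T x)).
    by apply: dot_continuous => // x; exact: cvg_id.
  rewrite /h => x; exact: (cvgB (cvgB (cdot x) (@F_cont x)) (@G_cont x)).
have c_b : continuous (fun x => phi x - F x).
  by move=> x; exact: (cvgB (@phi_cont x) (@F_cont x)).
have [A A0 hA] := bounded_on_spt spt_unit c_diag.
have [M M0 bM] := bounded_on_spt spt_unit c_b.
(* Constants A and M make all integrands nonnegative on the support, so that
   Tonelli applies; truncation at 0 extends this to the whole space. *)
pose k x z := Num.max (h x z) 0.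
pose B x := Num.max (phi x - F x + M) 0.
pose A' z := Num.max (h z z + A) 0.
have k0 x z : 0 <= k x z by rewrite le_max lexx orbT.
have B0 x : 0 <= B x by rewrite le_max lexx orbT.
have A'0 x : 0 <= A' x by rewrite le_max lexx orbT.
have BE x : spt mu x -> B x = phi x - F x + M.
  by move=> /bM; rewrite ler_norml => /andP[? _]; rewrite /B max_l//; lra.
have A'E x : spt mu x -> A' x = h x x + A.
  by move=> /hA; rewrite ler_norml => /andP[? _]; rewrite /A' max_l//; lra.
have mB : measurable_fun setT B by exact: cmax.
have mA' : measurable_fun setT A' by exact: cmax.
have mk1 z : measurable_fun setT (k ^~ z).
  exact: (measurableT_comp measurable_excess (pair2_measurable z)).
have mk2 x : measurable_fun setT (k x).
  exact: (measurableT_comp measurable_excess (pair1_measurable x)).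
have mkB : measurable_fun setT
    (fun p : 'rV[R]_d * 'rV[R]_d => (k p.1 p.2 * B p.1)%:E).
  apply/measurable_EFinP; apply: measurable_funM => //.
  by apply: (measurableT_comp (f := B) (g := fst)) => //; exact: measurable_fst.
have kBA x z : spt mu x -> spt mu z ->
    k x z * (B z + A) <= k x z * A' z + k x z * B x.
  move=> sx sz; rewrite -mulrDr; have [h0|h0] := leP (h x z) 0.
    by rewrite /k max_r// !mul0r.
  apply: ler_wpM2l => //; rewrite !BE// A'E//.
  have := tangent z x; move: h0; rewrite /h dotBl; lra.
pose I z := (\int[mu]_x (k x z * B x)%:E)%E.
have I0 z : (0 <= I z)%E.
  by apply: integral_ge0 => x _; rewrite lee_fin mulr_ge0.
have mI : measurable_fun setT I.
  apply: (measurable_fun_fubini_tonelli_G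
    (fun p : 'rV[R]_d * 'rV[R]_d => (k p.1 p.2 * B p.1)%:E)) => //.
  by move=> p; rewrite lee_fin mulr_ge0.
have ekA z (a : R) : 0 <= a -> (\int[mu]_x (k x z * a)%:E = (eps * a)%:E)%E.
  move=> a0; under eq_integral do rewrite EFinM.
  rewrite ge0_integralZr//; first by rewrite int_fst EFinM.
    exact/measurable_EFinP.
  by move=> x _; rewrite lee_fin.
have ekB x : (\int[mu]_z (k x z * B x)%:E = (eps * B x)%:E)%E.
  under eq_integral do rewrite EFinM.
  rewrite ge0_integralZr//; first by rewrite int_snd EFinM.
  - exact/measurable_EFinP.
  - by move=> z _; rewrite lee_fin.
  - by rewrite lee_fin.
have mkBz z : measurable_fun setT (fun x => (k x z * B x)%:E).
  by apply/measurable_EFinP; apply: measurable_funM.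
have mka z (a : R) : measurable_fun setT (fun x => (k x z * a)%:E).
  by apply/measurable_EFinP; apply: measurable_funM => //; exact: measurable_cst.
have kBz0 (z y : 'rV[R]_d) : (0 <= (k y z * B y)%:E)%E by rewrite lee_fin mulr_ge0.
have ka0 (z : 'rV[R]_d) (a : R) (y : 'rV[R]_d) : 0 <= a -> (0 <= (k y z * a)%:E)%E.
  by move=> a0; rewrite lee_fin mulr_ge0.
have inner z : spt mu z -> ((eps * (B z + A))%:E <= (eps * A' z)%:E + I z)%E.
  move=> sz; have BA0 : 0 <= B z + A by rewrite addr_ge0 ?(ltW A0).
  rewrite -(ekA z (B z + A))// -(ekA z (A' z))//.
  rewrite -(ge0_integralD mu measurableT (fun x _ => ka0 z (A' z) x (A'0 z))
    (mka z (A' z)) (fun x _ => kBz0 z x) (mkBz z)).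
  apply: le_integral_spt => [||x|x|x sx] //.
  - exact: emeasurable_funD.
  - exact: ka0.
  - by rewrite adde_ge0// ka0.
  - by rewrite -EFinD lee_fin kBA.
(* Exchanging the integrals turns the first marginal into the second. *)
have int_I : (\int[mu]_z I z = eps%:E * \int[mu]_x (B x)%:E)%E.
  rewrite -(fubini_tonelli
    (fun p : 'rV[R]_d * 'rV[R]_d => (k p.1 p.2 * B p.1)%:E))//=.
  under eq_integral do rewrite ekB EFinM.
  rewrite ge0_integralZl//; first exact/measurable_EFinP.
    by move=> x _; rewrite lee_fin.
  by rewrite lee_fin ltW.
have intB_fin : (\int[mu]_x (B x)%:E)%E \is a fin_num.
  rewrite ge0_fin_numE; last by apply: integral_ge0 => x _; rewrite lee_fin.
  apply: (@le_lt_trans _ _ (\int[mu]_x (M + M)%:E)%E); last first.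
    by rewrite integral_prob_cst ltry.
  apply: le_integral_spt => [||x|x|x sx]; rewrite ?lee_fin//.
  - exact/measurable_EFinP.
  - by rewrite addr_ge0 ?(ltW M0).
  - by rewrite BE// lerD2r (le_trans (ler_norm _))// bM.
have A_le : (A%:E <= \int[mu]_z (A' z)%:E)%E.
  have : (\int[mu]_z (eps * (B z + A))%:E <=
          \int[mu]_z ((eps * A' z)%:E + I z))%E.
    apply: le_integral_spt => [||z|z|z sz]; last exact: inner.
    - apply/measurable_EFinP; apply: measurable_funM; first exact: measurable_cst.
      by apply: measurable_funD => //; exact: measurable_cst.
    - apply: emeasurable_funD => //; apply/measurable_EFinP.
      by apply: measurable_funM => //; exact: measurable_cst.
    - by rewrite lee_fin mulr_ge0 ?addr_ge0 ?(ltW A0) ?(ltW eps0).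
    - by rewrite adde_ge0// lee_fin mulr_ge0// ltW.
  have -> : (\int[mu]_z (eps * (B z + A))%:E = eps%:E * (\int[mu]_z (B z)%:E + A%:E))%E.
    under eq_integral do rewrite EFinM.
    rewrite ge0_integralZl//; first last.
    - by rewrite lee_fin ltW.
    - by move=> z _; rewrite lee_fin addr_ge0 ?(ltW A0).
    - by apply/measurable_EFinP; apply: measurable_funD => //; exact: measurable_cst.
    under eq_integral do rewrite EFinD.
    rewrite (ge0_integralD mu measurableT _ _ (f2 := cst A%:E))//.
    - by rewrite integral_prob_cst.
    - by move=> z _; rewrite lee_fin.
    - exact/measurable_EFinP.
    - by move=> z _; rewrite lee_fin ltW.
  have -> : (\int[mu]_z ((eps * A' z)%:E + I z) =
      eps%:E * (\int[mu]_z (A' z)%:E + \int[mu]_z (B z)%:E))%E.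
    rewrite (ge0_integralD mu measurableT)//.
    - under eq_integral do rewrite EFinM.
      rewrite ge0_integralZl//; first last.
      + by rewrite lee_fin ltW.
      + by move=> z _; rewrite lee_fin.
      + exact/measurable_EFinP.
      rewrite int_I [RHS]ge0_muleDr//.
        by apply: integral_ge0 => z _; rewrite lee_fin.
      by apply: integral_ge0 => z _; rewrite lee_fin.
    - by move=> z _; rewrite lee_fin mulr_ge0 ?(ltW eps0).
    - by apply/measurable_EFinP; apply: measurable_funM => //; exact: measurable_cst.
  rewrite lee_pmul2l//.
  by rewrite addeC leeD2rE.
have total : ((eta + t)%:E * mu E + \int[mu]_z (A' z)%:E <= (eta + A)%:E)%E.
  have -> : (mu E = \int[mu]_x (\1_E x)%:E)%E by rewrite integral_indic// setIT.
  have m1E : measurable_fun setT (fun x => (\1_E x)%:E : \bar R).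
    by apply/measurable_EFinP; exact: measurable_indic.
  have m1E' : measurable_fun setT (fun x => ((eta + t)%:E * (\1_E x)%:E)%E).
    by apply: emeasurable_funM => //; exact: measurable_cst.
  have et0 : 0 <= eta + t by rewrite addr_ge0.
  rewrite -ge0_integralZl//.
  rewrite -(ge0_integralD mu measurableT)//; last 3 first.
  - by move=> x _; rewrite -EFinM lee_fin mulr_ge0.
  - by move=> x _; rewrite lee_fin.
  - exact/measurable_EFinP.
  have <- : (\int[mu]_x (eta + A)%:E = (eta + A)%:E)%E.
    by rewrite integral_prob_cst.
  apply: le_integral_spt => [||x|x|x sx].
  - by apply: emeasurable_funD => //; exact/measurable_EFinP.
  - exact: measurable_cst.
  - by rewrite -EFinM -EFinD lee_fin addr_ge0// mulr_ge0.
  - by rewrite lee_fin addr_ge0// ltW.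
  rewrite -EFinM -EFinD lee_fin A'E// indicE.
  have [/set_mem Ex|_] := boolP (x \in E).
    by rewrite mulr1; have := h_t x sx Ex; lra.
  by rewrite mulr0 add0r lerD2r h_eta.
have := le_trans (leeD2l _ A_le) total.
by rewrite (EFinD eta A) leeD2rE.
Qed.

End DiagonalMass.

(** * Chaining along segments *)

Section Chain.
Context {R : realType} {d : nat}.
Variables (S : set 'rV[R]_d) (b : 'rV[R]_d -> R) (c q : R).
Hypothesis one_step : forall x y, S x -> S y ->
  b y - b x <= c + q * enorm (y - x) ^+ 2.

(** The quadratic part of the one-step error is divided by n when the segment
    is cut into n pieces, at the price of n times the constant part. *)
Lemma chain_le (u v : 'rV[R]_d) (n : nat) : (0 < n)%N ->
  (forall t, 0 <= t <= 1 -> S (u + t *: (v - u))) ->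
  b v - b u <= n%:R * c + q * enorm (v - u) ^+ 2 / n%:R.
Proof.
move=> n0 uvS; have nR0 : 0 < n%:R :> R by rewrite ltr0n.
pose p i := u + (i%:R / n%:R) *: (v - u).
have pS i : (i <= n)%N -> S (p i).
  move=> ni; apply: uvS; rewrite divr_ge0//=.
  by rewrite ler_pdivrMr// mul1r ler_nat.
have chain i : (i <= n)%N ->
    b (p i) - b u <= i%:R * (c + q * enorm (v - u) ^+ 2 / n%:R ^+ 2).
  elim: i => [_|i IH ni].
    by rewrite /p mul0r scale0r addr0 subrr mul0r.
  have := one_step (pS _ (ltnW ni)) (pS _ ni).
  have -> : p i.+1 - p i = n%:R^-1 *: (v - u).
    rewrite /p opprD addrACA subrr add0r -scalerBl -mulrBl.
    by rewrite -natrB// subSnn mul1r.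
  rewrite enormZ exprMn real_normK ?num_real// exprVn.
  have -> : q * (n%:R ^- 2 * enorm (v - u) ^+ 2) = q * enorm (v - u) ^+ 2 / n%:R ^+ 2.
    by rewrite [n%:R ^- 2 * _]mulrC mulrA.
  have := IH (ltnW ni); rewrite -natr1.
  move: (_ / n%:R ^+ 2) => a; lra.
have := chain n (leqnn n); rewrite /p divff ?gt_eqF// scale1r [u + _]addrC subrK.
move=> /le_trans; apply; rewrite mulrDr lerD2l.
rewrite (_ : n%:R * _ = q * enorm (v - u) ^+ 2 / n%:R)//.
by field; rewrite gt_eqF.
Qed.

End Chain.

(** * Stability of the optimality conditions *)

Section Stability.
Context {R : realType} {d : nat}.
Variables (mu : probability 'rV[R]_d R) (T : 'rV[R]_d -> 'rV[R]_d).
Variables (phi F G : 'rV[R]_d -> R) (eps L : R).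
Hypothesis spt_unit : spt mu `<=` eball 0 1.
Hypothesis T_unit : forall x, spt mu x -> enorm (T x) < 1.
Hypothesis tangent : forall x y, phi x + dot (y - x) (T x) <= phi y.
Hypothesis lipT : forall x y, enorm (T x - T y) <= L * enorm (x - y).
Hypothesis lipF : forall x y, F x - F y <= enorm (x - y).
Hypothesis lipG : forall x y, G x - G y <= enorm (x - y).
Hypotheses (phi_cont : continuous phi) (F_cont : continuous F).
Hypotheses (GT_cont : continuous (G \o T)).
Hypotheses (eps0 : 0 < eps) (L0 : 0 <= L).

Let h x z := dot x (T z) - F x - G (T z).

Hypothesis int_fst :
  forall z, (\int[mu]_x (Num.max (h x z) 0)%:E = eps%:E)%E.
Hypothesis int_snd :
  forall x, (\int[mu]_z (Num.max (h x z) 0)%:E = eps%:E)%E.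

Let d1 := spread mu eps.
Let d2 := spread mu (d1 / (L + 1)).

Let L1 : 0 < L + 1. Proof. by rewrite ltr_wpDl. Qed.

Let T_cont : continuous T.
Proof. exact: lipschitz_continuous lipT. Qed.

Let unit_spt x : spt mu x -> enorm x < 1.
Proof. exact: spt_enorm_lt1. Qed.

(** With r = h(x, z) / 4, the excess h(., z) is 2-Lipschitz, hence at least 2 r
    on B(x, r), and its positive part integrates to eps. *)
Lemma excess_le x z : spt mu x -> spt mu z -> h x z <= 4 * d1.
Proof.
move=> sx sz; rewrite -ler_pdivrMl//.
have d10 : 0 <= d1 by apply: le_trans (ltW eps0) (spread_ge spt_unit sx eps0).
have [h0|h0] := leP (h x z) 0.
  by apply: le_trans d10; rewrite mulr_ge0_le0.
apply: (le_spread spt_unit sx); rewrite mulrC.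
set r := h x z / 4; have r0 : 0 < r by rewrite divr_gt0.
have mball := measurable_eball x r.
have -> : (mu (eball x r) = \int[mu]_y (\1_(eball x r) y)%:E)%E.
  by rewrite integral_indic// setIT.
rewrite -ge0_integralZl//; first last.
- by rewrite lee_fin ltW.
- by apply/measurable_EFinP; exact: measurable_indic.
rewrite -(int_fst z); apply: ge0_le_integral => //.
- by move=> y _; rewrite -EFinM lee_fin mulr_ge0// ltW.
- apply: emeasurable_funM; first exact: measurable_cst.
  by apply/measurable_EFinP; exact: measurable_indic.
- apply/measurable_EFinP; apply: measurable_maxr; last exact: measurable_cst.
  apply: continuous_measurable_rV => y.
  have cdot : continuous (fun y => dot y (T z)).
    by apply: dot_continuous; [move=> ?; exact: cvg_id|exact: cst_continuous].
  exact: (cvgB (cvgB (cdot y) (@F_cont y)) (cvg_cst (G (T z)))).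
move=> y _; rewrite -EFinM lee_fin indicE.
have [/set_mem yB|_] := boolP (y \in eball x r); last first.
  by rewrite mulr0 le_max lexx orbT.
rewrite mulr1 le_max; apply/orP; left.
have := lipF y x; have := dot_ge_unit (y - x) (T_unit sz).
have : enorm (y - x) < r by [].
have : h x z = 4 * r by rewrite /r; lra.
rewrite dotBl /h; lra.
Qed.

Lemma spread_le_spread_spread x : spt mu x -> d1 <= (L + 1) * d2.
Proof.
move=> sx; have d10 : 0 < d1 by apply: lt_le_trans eps0 (spread_ge spt_unit sx eps0).
rewrite -ler_pdivrMl// mulrC; apply: (spread_ge spt_unit sx).
by rewrite divr_gt0.
Qed.

(** The diagonal excess has nonnegative mean, so where it is very negative the
    measure is small; being Lipschitz, it is then very negative on a whole
    ball. *)
Lemma diagonal_ge x : spt mu x -> - (8 * (L + 1) * d2) <= h x x.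
Proof.
move=> sx; rewrite lerNl -ler_pdivrMl ?mulr_gt0//.
have d10 : 0 < d1 by apply: lt_le_trans eps0 (spread_ge spt_unit sx eps0).
have [h0|h0] := leP 0 (h x x).
  apply: (@le_trans _ _ 0).
    by rewrite mulr_ge0_le0// ?oppr_le0// invr_ge0 mulr_ge0// ltW.
  have := spread_le_spread_spread sx; rewrite -ler_pdivrMl//; apply: le_trans.
  by rewrite mulr_ge0// ?invr_ge0 ltW.
set r := _^-1 * _.
have hr : h x x = - (8 * (L + 1) * r).
  by rewrite /r mulVKf ?opprK// gt_eqF// mulr_gt0.
have r0 : 0 < r by rewrite /r mulr_gt0 ?invr_gt0 ?mulr_gt0// oppr_gt0.
have Lr0 : 0 < (L + 1) * r by rewrite mulr_gt0.
apply: (le_spread spt_unit sx).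
(* x |-> h(x, x) is 2 (L + 1)-Lipschitz on the support and equals
   - 8 (L + 1) r at x, so it is at most - 6 (L + 1) r on B(x, r). *)
have : ((4 * d1 + 6 * ((L + 1) * r))%:E * mu (eball x r) <= (4 * d1)%:E)%E.
  apply: (diagonal_mass_le (T := T) (phi := phi) (F := F) (G := G \o T) (eps := eps)) => //.
  - by rewrite mulr_ge0// ltW.
  - by rewrite mulr_ge0// ltW.
  - exact: measurable_eball.
  - by move=> y sy; exact: excess_le.
  move=> y sy yB; have yr : enorm (y - x) < r by [].
  have := lipF x y; have := lipG (T x) (T y); have := lipT y x.
  rewrite [enorm (x - y)]enorm_distC [enorm (T x - T y)]enorm_distC.
  have := dot_le_unit (y - x) (T_unit sx).
  have : dot y (T y - T x) <= enorm (T y - T x).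
    by rewrite dotC dot_le_unit// unit_spt.
  have : (L + 1) * enorm (y - x) <= (L + 1) * r by rewrite ler_pM2l// ltW.
  move: hr; rewrite /h /= dotBl dotBr; lra.
move=> mass; rewrite -(@lee_pmul2l _ (6 * (L + 1))%:E)//; last by rewrite lte_fin mulr_gt0.
rewrite muleA -!EFinM.
apply: (@le_trans _ _ (4 * d1)%:E).
  apply: le_trans mass; apply: lee_wpmul2r => //.
  by rewrite lee_fin -mulrA lerDr mulr_ge0// ltW.
rewrite lee_fin (_ : 6 * (L + 1) * _ = 6 * d1); first by rewrite ler_pM2r// ler_nat.
by field; rewrite gt_eqF.
Qed.

(** T x is an approximate subgradient of F at x, by the bounds on h(x, x) and
    h(y, x), while phi exceeds its tangent plane by a quadratic term only. *)
Lemma potential_step x y : spt mu x -> spt mu y ->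
  (F y - phi y) - (F x - phi x) <=
    16 * (L + 1) * d2 + (L + 1) * enorm (y - x) ^+ 2.
Proof.
move=> sx sy; have := diagonal_ge sy; have := excess_le sx sy.
have := spread_le_spread_spread sx.
have := smooth_le tangent lipT y x.
rewrite [enorm (x - y)]enorm_distC; have := sqr_ge0 (enorm (y - x)).
have : 0 <= (L + 1) * d2 .
  apply: le_trans (spread_le_spread_spread sx).
  exact: le_trans (ltW eps0) (spread_ge spt_unit sx eps0).
rewrite /h dotBl; lra.
Qed.

Lemma star_potential_le x z (n : nat) : (0 < n)%N -> star_shaped (spt mu) ->
  spt mu x -> spt mu z ->
  (F z - phi z) - (F x - phi x) <=
    2 * (n%:R * (16 * (L + 1) * d2) + 4 * (L + 1) / n%:R).
Proof.
move=> n0 [x0 s0 star] sx sz.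
have nR0 : 0 < n%:R :> R by rewrite ltr0n.
have far u v : spt mu u -> spt mu v ->
    (L + 1) * enorm (v - u) ^+ 2 / n%:R <= 4 * (L + 1) / n%:R.
  move=> su sv; rewrite ler_pM2r ?invr_gt0// mulrC ler_pM2r//.
  have := enorm_sub_unit (unit_spt sv) (unit_spt su); have := enorm_ge0 (v - u).
  move: (enorm _) => a; nra.
have toc := @chain_le _ _ (spt mu) (fun y => F y - phi y) _ _ potential_step.
have h1 : (F x0 - phi x0) - (F x - phi x) <=
    n%:R * (16 * (L + 1) * d2) + 4 * (L + 1) / n%:R.
  apply: le_trans (toc _ _ n n0 _) _ => [t t01|]; last by rewrite lerD2l far.
  rewrite scalerBr addrCA -{1}(scale1r x) -scalerBl; exact: star.
have h2 : (F z - phi z) - (F x0 - phi x0) <=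
    n%:R * (16 * (L + 1) * d2) + 4 * (L + 1) / n%:R.
  apply: le_trans (toc _ _ n n0 _) _ => [t t01|]; last by rewrite lerD2l far.
  have t01' : 0 <= 1 - t <= 1 by lra.
  have := star _ sz _ t01'; rewrite subKr scalerBl scale1r scalerBr.
  by rewrite addrAC -addrA.
lra.
Qed.

(** Cutting the segments to the star centre into about 1 / sqrt d2 pieces
    balances the two error terms of the chain. *)
Lemma active_close x z : star_shaped (spt mu) -> spt mu x -> spt mu z ->
  0 < h x z ->
  enorm (T z - T x) <= 18 * (L + 1) * Num.sqrt (Num.max (Num.sqrt d2) d2).
Proof.
move=> star sx sz hxz; set m := Num.max _ _.
have d10 : 0 < d1 by apply: lt_le_trans eps0 (spread_ge spt_unit sx eps0).
have d1d2 := spread_le_spread_spread sx.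
have d20 : 0 < d2 by rewrite -(pmulr_rgt0 _ L1) (lt_le_trans d10).
set s := Num.sqrt d2 in m *; have s0 : 0 < s by rewrite sqrtr_gt0.
have ss : s ^+ 2 = d2 by rewrite sqr_sqrtr// ltW.
have ms : s <= m by rewrite le_max lexx.
have md : d2 <= m by rewrite le_max lexx orbT.
pose n := (Num.truncn s^-1).+1.
have [n_ge n_le] : s^-1 <= n%:R /\ n%:R <= s^-1 + 1.
  have si0 : 0 <= s^-1 by rewrite invr_ge0 ltW.
  have /andP[tl tg] := Num.Theory.truncn_itv si0.
  by rewrite -[n%:R]natr1 lerD2r; split; [rewrite natr1 ltW|].
(* As h(x, z) > 0 and h(z, z) <= 4 d1, the slope T z from z to x is nearly
   matched by F, hence by phi. *)
have key : phi x - phi z - dot (x - z) (T z) <= 80 * (L + 1) * m.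
  have chain := star_potential_le (n := n) isT star sx sz.
  have nd : n%:R * d2 <= s + d2.
    rewrite -ss; apply: (@le_trans _ _ ((s^-1 + 1) * s ^+ 2)).
      by rewrite ler_pM2r// exprn_gt0.
    by rewrite mulrDl mul1r expr2 mulKf ?gt_eqF.
  have ninv : n%:R^-1 <= s.
    by rewrite -[leRHS]invrK lef_pV2// posrE ?invr_gt0// ltr0n.
  have := excess_le sz sz; move: hxz; rewrite /h dotBl.
  have : (L + 1) * (n%:R * d2) <= (L + 1) * (2 * m) by rewrite ler_pM2l//; lra.
  have : (L + 1) * n%:R^-1 <= (L + 1) * m by rewrite ler_pM2l//; lra.
  have : (L + 1) * d2 <= (L + 1) * m by rewrite ler_pM2l.
  move: chain; nra.
have lipT1 u v : enorm (T u - T v) <= (L + 1) * enorm (u - v).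
  by rewrite (le_trans (lipT u v))// mulrDl lerDl mul1r enorm_ge0.
have gap := tangent_gap_ge tangent lipT1 x z L1.
have m0 : 0 <= m by lra.
rewrite enorm_distC -(ler_pXn2r (n := 2))// ?nnegrE ?enorm_ge0//; last first.
  by rewrite mulr_ge0 ?sqrtr_ge0// mulr_ge0// ltW.
apply: (le_trans gap); rewrite exprMn sqr_sqrtr//.
apply: (@le_trans _ _ (4 * (L + 1) * (80 * (L + 1) * m))).
  by rewrite ler_pM2l// mulr_gt0.
have : 0 <= (L + 1) ^+ 2 * m by rewrite mulr_ge0// sqr_ge0.
rewrite !expr2; lra.
Qed.

End Stability.

(** * Pushforward, product supports and the theorem *)

Section QuadraticOT.
Context {R : realType} {d : nat}.
Implicit Types (mu nu : probability 'rV[R]_d R) (f g : 'rV[R]_d -> R).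
Implicit Types (T : 'rV[R]_d -> 'rV[R]_d).

Lemma integral_push mu nu T (u : 'rV[R]_d -> R) : continuous T ->
  (forall A, measurable A -> nu A = pushforward mu T A) ->
  measurable_fun setT u -> (forall y, 0 <= u y) ->
  (\int[nu]_y (u y)%:E = \int[mu]_x (u (T x))%:E)%E.
Proof.
move=> cT nuT mu_ u0; have mT := continuous_measurable_rV_rV cT.
rewrite (eq_measure_integral (pushforward mu T)); last first.
  by move=> A mA _; exact: nuT.
rewrite (ge0_integral_pushforward mT)//.
  exact/measurable_EFinP.
by move=> y _; rewrite lee_fin.
Qed.

Lemma spt_push mu nu T x : continuous T ->
  (forall A, measurable A -> nu A = pushforward mu T A) ->
  spt mu x -> spt nu (T x).
Proof.
move=> /continuousP cT nuT sx U oU UTx.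
by rewrite nuT; [apply: sx => //; exact: cT|exact: open_measurable_rV].
Qed.

(** The support of mu has full measure, so its image meets every open set
    charged by the pushforward. *)
Lemma spt_push_meets mu nu T y (V : set 'rV[R]_d) : continuous T ->
  (forall A, measurable A -> nu A = pushforward mu T A) ->
  spt nu y -> open V -> V y -> exists2 z, spt mu z & V (T z).
Proof.
move=> /continuousP cT nuT sy oV Vy.
have := sy V oV Vy; rewrite nuT; last exact: open_measurable_rV.
apply: contraPP => noz; apply/negP; rewrite -leNgt -(spt_null mu).
rewrite /pushforward; apply: le_measure; rewrite ?inE.
- by apply: open_measurable_rV; exact: cT.
- by apply: measurableC; exact: measurable_spt.
by move=> z Vz sz; apply: noz; exists z.
Qed.

Lemma spt_prod mu nu x y : spt (mu \x nu)%E (x, y) -> spt mu x /\ spt nu y.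
Proof.
move=> sxy; split=> U oU.
- move=> Ux; have oU1 : open (fst @^-1` U : set ('rV[R]_d * 'rV[R]_d)).
    by apply: open_comp => // p _; exact: cvg_fst.
  have := sxy _ oU1 Ux; rewrite (_ : fst @^-1` U = U `*` setT); last first.
    by apply/seteqP; split => p //= [].
  rewrite product_measure1E//; last exact: open_measurable_rV.
  rewrite [X in (_ * X)%E](_ : _ = 1%E) ?mule1//; exact: probability_setT.
- move=> Uy; have oU2 : open (snd @^-1` U : set ('rV[R]_d * 'rV[R]_d)).
    by apply: open_comp => // p _; exact: cvg_snd.
  have := sxy _ oU2 Uy; rewrite (_ : snd @^-1` U = setT `*` U); last first.
    by apply/seteqP; split => p //= [].
  rewrite product_measure1E//; last exact: open_measurable_rV.
  rewrite [X in (X * _)%E](_ : _ = 1%E) ?mul1e//; exact: probability_setT.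
Qed.

Lemma lipschitz_grad_ge0 phi (L : R) : (0 < d)%N -> 
  @lipschitz_grad R d L phi -> 0 <= L.
Proof.
move=> d0 [_ /(_ (delta_mx ord0 (Ordinal d0)) 0)]; rewrite subr0.
have e1 : 0 < enorm (delta_mx ord0 (Ordinal d0) : 'rV[R]_d).
  apply: lt_le_trans (norm_coord_le_enorm _ (Ordinal d0)).
  by rewrite mxE !eqxx normr1.
by move=> /(le_trans (enorm_ge0 _)); rewrite pmulr_lge0.
Qed.

End QuadraticOT.

Unset Implicit Arguments.

Theorem theorem5p3 (R : realType) :
  exists2 C : R, 0 < C &
  forall (d : nat) (mu nu : probability 'rV[R]_d R) (phi : 'rV[R]_d -> R)
         (L eps : R) (f g : 'rV[R]_d -> R),
    (0 < d)%N ->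
    standing_assumptions mu nu ->
    brenier_potential mu nu phi ->
    0 < eps ->
    lipschitz_grad L phi ->
    star_shaped (spt mu) ->
    qot_potentials mu nu eps f g ->
    forall x y : 'rV[R]_d, spt_qot mu nu f g (x, y) ->
      enorm (y - grad phi x) <=
        C * (L + 1) `^ (3 / 2) *
        Num.max (spread mu (spread mu eps / (L + 1)) `^ (1 / 4))
                (Num.sqrt (spread mu (spread mu eps / (L + 1)))).
Proof.
exists 18; first by [].
move=> d mu nu phi L eps f g d0 [_ mu1 _ nu1] [cvx push] eps0 lipg star.
move=> [cf cg int_mu int_nu] x y.
have L0 := lipschitz_grad_ge0 d0 lipg; case: lipg => dphi lipT.
set T := grad phi in push lipT *.
have cT : continuous T := lipschitz_continuous lipT.
have tangent u v : phi u + dot (v - u) (T u) <= phi v by exact: tangent_le.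
have phi_cont : continuous phi by move=> u; exact: (differentiable_continuous (dphi u)).
pose F u := 2^-1 * dot u u - f u.
pose G v := 2^-1 * dot v v - g v.
have excessE u v : f u + g v - cost u v = dot u v - F u - G v.
  by rewrite costE /F /G; lra.
have csq : continuous (fun u : 'rV[R]_d => 2^-1 * dot u u : R).
  have cdot : continuous (fun u : 'rV[R]_d => dot u u).
    by apply: dot_continuous => u; exact: cvg_id.
  by move=> u; exact: (cvgM (cvg_cst (2^-1 : R)) (cdot u)).
have cF : continuous F by move=> u; exact: (cvgB (csq u) (cf u)).
have cG : continuous G by move=> u; exact: (cvgB (csq u) (cg u)).
have int_F v : (\int[mu]_u (Num.max (dot u v - F u - G v) 0)%:E = eps%:E)%E.
  by rewrite -(int_mu v); apply: eq_integral => u _; rewrite excessE.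
have int_G u : (\int[nu]_v (Num.max (dot u v - F u - G v) 0)%:E = eps%:E)%E.
  by rewrite -(int_nu u); apply: eq_integral => v _; rewrite excessE.
have lipG : forall u v, G u - G v <= enorm (u - v).
  exact: (potential_lipschitz mu1 cF eps0 int_F).
have lipF : forall u v, F u - F v <= enorm (u - v).
  apply: (potential_lipschitz nu1 cG eps0) => u.
  rewrite -(int_G u); apply: eq_integral => v _.
  by rewrite dotC addrAC.
have c_excess u : continuous (fun v => dot u v - F u - G v).
  have cdot : continuous (dot u).
    by apply: dot_continuous; [exact: cst_continuous|move=> v; exact: cvg_id].
  by move=> v; exact: (cvgB (cvgB (cdot v) (cvg_cst (F u))) (cG v)).
have int_GT u : (\int[mu]_z (Num.max (dot u (T z) - F u - G (T z)) 0)%:E = eps%:E)%E.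
  rewrite -(int_G u).
  rewrite (integral_push (u := fun v => Num.max (dot u v - F u - G v) 0) cT push)//.
    apply: measurable_maxr; last exact: measurable_cst.
    by apply: continuous_measurable_rV; exact: c_excess.
  by move=> v; rewrite le_max lexx orbT.
have T_unit z : spt mu z -> enorm (T z) < 1.
  by move=> sz; apply: (spt_enorm_lt1 nu1); exact: spt_push sz.
have GT_cont : continuous (G \o T) 
  by move=> u; apply: (@continuous_comp _ _ _ T G); [exact: cT|exact: cG].
set d2 := spread mu (_ / (L + 1)).
pose bound : R := 18 * (L + 1) * Num.sqrt (Num.max (Num.sqrt d2) d2).
have active u v : spt mu u -> spt nu v -> 0 < dot u v - F u - G v ->
    enorm (v - T u) <= bound.
  move=> su sv uv; rewrite leNgt; apply/negP => far.
  pose V := [set w | 0 < dot u w - F u - G w] `&`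
    [set w : 'rV[R]_d | bound < enorm (w - T u)].
  have oV : open V.
    apply: openI.
      apply: (@open_comp _ _ (fun w => dot u w - F u - G w) [set s | 0 < s]);
        last exact: open_gt.
      by move=> w _; exact: c_excess.
    apply: (@open_comp _ _ (fun w : 'rV[R]_d => enorm (w - T u))
      [set s | bound < s]);
      last exact: open_gt.
    by move=> w _; exact: enorm_sub_continuous.
  (* Positivity of the excess is an open condition, so v may be replaced by a
     nearby point of the form T z. *)
  have [z sz [uz zfar]] := spt_push_meets cT push sv oV (conj uv far).
  move: zfar; rewrite /= ltNge => /negP; apply.
  exact: (active_close mu1 T_unit tangent lipT lipF lipG phi_cont cF GT_cont
    eps0 L0 (fun w => int_F (T w)) int_GT star su sz uz).
have closed_graph : closed [set p : 'rV[R]_d * 'rV[R]_d | enorm (p.2 - T p.1) <= bound].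
  apply: (@preimage_closed _ _ (fun p : 'rV[R]_d * 'rV[R]_d => enorm (p.2 - T p.1))
    [set s | s <= bound]); last exact: closed_le.
  move=> p _; apply: (@continuous_comp _ _ _
    (fun p : 'rV[R]_d * 'rV[R]_d => p.2 - T p.1) (@enorm R d)).
    apply: (@cvgB _ _ _ (nbhs p)); first exact: cvg_snd.
    by apply: (@continuous_comp _ _ _ fst T); [exact: cvg_fst|exact: cT].
  exact: enorm_continuous.
move=> qxy; have : enorm (y - T x) <= bound.
  apply: (closed_graph (x, y)); apply: closureS qxy => -[u v] [/= suv uv].
  have [su sv] := spt_prod suv.
  by apply: active => //; rewrite -excessE subr_gt0.
move=> /le_trans; apply.
have d20 : 0 <= d2.
  have [x0 s0 _] := star; have L1 : 0 < L + 1 by rewrite ltr_wpDl.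
  have d10 := lt_le_trans eps0 (spread_ge mu1 s0 eps0).
  have q0 := divr_gt0 d10 L1.
  exact: le_trans (ltW q0) (spread_ge mu1 s0 q0).
have L1 : 1 <= L + 1 by rewrite lerDr.
rewrite /bound; apply: ler_pM.
- by rewrite mulr_ge0// ltW// (lt_le_trans ltr01).
- exact: sqrtr_ge0.
- rewrite ler_pM2l// -[leLHS]powRr1 ?(le_trans ler01)//.
  by apply: ler_powR => //; lra.
have [sd|ds] := leP (Num.sqrt d2) d2.
  by rewrite le_max lexx orbT.
rewrite le_max -!powR12_sqrt ?powR_ge0// -powRrM.
by rewrite (_ : 2^-1 * 2^-1 = 1 / 4 :> R) ?lexx//; field.
Qed.
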